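(* Consider the renewal system and the iterative algorithm described in the context, run with an arbitrary deterministic $\theta[0]\in[\theta_{min},\theta_{max}]$ and stepsizes $\eta[k]=\frac{1}{(k+2)T_{min}}$ for $k\in\{0,1,2,\ldots\}$. Then for all $K\in\{2,3,4,\ldots\}$, $$\left|\theta^*-\frac{\sum_{k=0}^{K-1}\mathbb{E}[R[k]]}{\sum_{k=0}^{K-1}\mathbb{E}[T[k]]}\right|\le\frac{\sqrt{2C_1}}{K\,T_{min}}\left[|\theta[0]-\theta^*|+\frac{-\sqrt{2b}+\sqrt{8b(K-1)}}{T_{min}}\right].$$ Hence the deviation from the optimal ratio $\theta^*$ decays like $O(1/\sqrt{K})$.
   Context: System: $\{S[k]\}_{k=0}^\infty$ is an i.i.d. sequence of random vectors with values in $\Omega_S\subseteq\mathbb{R}^m$. For each $s\in\Omega_S$, $\mathcal{D}(s)$ is a compact subset of $(0,\infty)\times(-\infty,\infty)$. On each frame $k\in\{0,1,2,\ldots\}$ a decision $(T[k],R[k])\in\mathcal{D}(S[k])$ is chosen; $T[k]$ and $R[k]$ are random variables (measurable). There are functions $L,M:\Omega_S\to[0,\infty)$ with $t\ge L(s)$ and $t^2+r^2\le M(s)$ for all $(t,r)\in\mathcal{D}(s)$, $s\in\Omega_S$, such that $L(S[0]),M(S[0])$ are random variables with $\mathbb{E}[L(S[0])]>0$ and $\mathbb{E}[M(S[0])]<\infty$. Consequently there are constants $T_{min}>0$, $T_{max}$, $R_{min}$, $R_{max}$, $C_1$, $C_2$ (fixed throughout) such that, regardless of how decisions are made, for all $k$: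 $T_{min}\le\mathbb{E}[T[k]]\le T_{max}$, $R_{min}\le\mathbb{E}[R[k]]\le R_{max}$, $\mathbb{E}[T[k]^2]\le C_1$, $\mathbb{E}[R[k]^2]\le C_2$. Optimal ratio: $\mathcal{A}\subseteq\mathbb{R}^2$ is the set of all one-shot expectations $(\mathbb{E}[T[0]],\mathbb{E}[R[0]])$ achievable on frame $0$ over all (measurable, possibly randomized) conditional distributions for choosing $(T[0],R[0])\in\mathcal{D}(S[0])$ given $S[0]$; $\overline{\mathcal{A}}$ is its closure. $\theta^*=\sup_{(t,r)\in\overline{\mathcal{A}}}\{r/t\}$. The finite constants $\theta_{min},\theta_{max}$ satisfy $\theta_{min}\le\theta^*\le\theta_{max}$. Algorithm: given deterministic $\theta[0]\in[\theta_{min},\theta_{max}]$ and deterministic positive stepsizes $\{\eta[k]\}$, on each frame $k$: observe $S[k]$ and $\theta[k]$; choose $(T[k],R[k])\in\mathcal{D}(S[k])$ to maximize $R[k]-\theta[k]T[k]$ (ties broken by an arbitrary rule making $(T[k],R[k])$ a measurable function of $(\theta[k],S[k])$); then update $\theta[k+1]=\big[\theta[k]+\eta[k](R[k]-\theta[k]T[k])\big]_{\theta_{min}}^{\theta_{max}}$, where $[x]_{\theta_{min}}^{\theta_{max}}$ is the projection of $x$ onto $[\theta_{min},\theta_{max}]$. The constant $b$ satisfies $\frac12\mathbb{E}[(R[k]-\theta[k]T[k])^2]\le b$ for all $k\in\{0,1,2,\ldots\}$ under this algorithm. *)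

(* Defs.v *)
From HB Require Import structures.
From mathcomp Require Import all_boot all_order all_algebra finmap.
From mathcomp Require Import all_classical all_reals all_analysis.

Set Implicit Arguments.
Unset Strict Implicit.
Unset Printing Implicit Defensive.

Import Order.TTheory GRing.Theory Num.Theory.
Import numFieldNormedType.Exports.

Local Open Scope classical_set_scope.
Local Open Scope ring_scope.

(* Points of R^m are m-tuples, with the product (equivalently, Borel)
   sigma-algebra; a decision (t, r) is a point of R * R. *)

Section IID.
Context {d d' : measure_display} {Omega : measurableType d}
  {X : measurableType d'} {R : realType}.
Variable P : probability Omega R.

Definition mutually_independent (S : nat -> Omega -> X) : Prop :=
  forall (J : {fset nat}) (A : nat -> set X),
    (forall i, i \in J -> measurable (A i)) ->
    P (\bigcap_(i in [set` J]) (S i @^-1` A i))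
    = (\prod_(i <- J) P (S i @^-1` A i))%E.

Definition identically_distributed (S : nat -> Omega -> X) : Prop :=
  forall (k : nat) (A : set X), measurable A ->
    P (S k @^-1` A) = P (S 0%N @^-1` A).

Definition iid (S : nat -> Omega -> X) : Prop :=
  [/\ forall k, measurable_fun [set: Omega] (S k),
      mutually_independent S & identically_distributed S].

End IID.

Section Renewal.
Context {d : measure_display} {Omega : measurableType d} {R : realType}
  {m : nat}.
Variables (P : probability Omega R) (OmegaS : set (m.-tuple R))
  (D : m.-tuple R -> set (R * R)) (S : nat -> Omega -> m.-tuple R).

Definition renewal_system (L M : m.-tuple R -> R) : Prop :=
  [/\ iid P S /\ (forall k w, OmegaS (S k w)),
      forall s, OmegaS s ->
        compact (D s) /\ (forall x, D s x -> 0 < x.1),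
      forall s, OmegaS s ->
        [/\ 0 <= L s, 0 <= M s &
          forall x, D s x -> L s <= x.1 /\ x.1 ^+ 2 + x.2 ^+ 2 <= M s],
      measurable_fun [set: Omega] (L \o S 0%N) /\
        measurable_fun [set: Omega] (M \o S 0%N)
    & (0 < 'E_P[L \o S 0%N])%E /\ ('E_P[M \o S 0%N] < +oo)%E].

(* A conditional distribution for a (possibly randomized) decision given the
   value s of S[k]. Its values outside OmegaS are irrelevant: OmegaS need not
   be Borel, and S[k] takes its values in OmegaS. *)
Definition admissible (kappa : R.-pker (m.-tuple R) ~> (R * R)%type) : Prop :=
  forall s, OmegaS s -> kappa s (D s) = 1%E.

(* E[f(T[k], R[k])] when (T[k], R[k]) has conditional distribution kappa
   given S[k]. *)
Definition policy_mean (kappa : R.-pker (m.-tuple R) ~> (R * R)%type) (k : nat)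
    (f : R * R -> R) : \bar R :=
  (\int[P]_w \int[kappa (S k w)]_x (f x)%:E)%E.

(* Bounds valid however decisions are made: the expectations on frame k depend
   on the decision mechanism only through the conditional distribution of
   (T[k], R[k]) given S[k]. *)
Definition moment_bounds (Tmin Tmax Rmin Rmax C1 C2 : R) : Prop :=
  forall (k : nat) (kappa : R.-pker (m.-tuple R) ~> (R * R)%type),
    admissible kappa ->
    [/\ (Tmin%:E <= policy_mean kappa k (fun x => x.1) <= Tmax%:E)%E,
        (Rmin%:E <= policy_mean kappa k (fun x => x.2) <= Rmax%:E)%E,
        (policy_mean kappa k (fun x => x.1 ^+ 2)%R <= C1%:E)%E
      & (policy_mean kappa k (fun x => x.2 ^+ 2)%R <= C2%:E)%E].

(* The one-shot expectations (E[T[0]], E[R[0]]). *)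
Definition one_shot_means : set (R * R) :=
  [set p | exists2 kappa : R.-pker (m.-tuple R) ~> (R * R)%type,
     admissible kappa &
     policy_mean kappa 0 (fun x => x.1) = (p.1)%:E /\
     policy_mean kappa 0 (fun x => x.2) = (p.2)%:E].

Definition optimal_ratio : R :=
  sup [set p.2 / p.1 | p in closure one_shot_means].

Section Algorithm.
Variables (thmin thmax th0 : R) (eta : nat -> R)
  (phi : nat -> R * m.-tuple R -> R * R).

(* phi k (th, s) is the decision taken on frame k when theta[k] = th and
   S[k] = s; measurability on the whole space rather than on
   [thmin, thmax] x OmegaS is no loss, as a real function that is measurable
   for the trace sigma-algebra on a subset extends measurably. *)
Definition greedy_rule : Prop :=
  forall k, measurable_fun setT (phi k) /\
    forall th s, thmin <= th <= thmax -> OmegaS s ->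
      D s (phi k (th, s)) /\
      (forall x, D s x ->
         x.2 - th * x.1 <= (phi k (th, s)).2 - th * (phi k (th, s)).1).

(* [x]_thmin^thmax *)
Definition proj_itv (x : R) : R := Num.max thmin (Num.min x thmax).

Fixpoint theta (k : nat) (w : Omega) : R :=
  if k is j.+1 then
    let x := phi j (theta j w, S j w) in
    proj_itv (theta j w + eta j * (x.2 - theta j w * x.1))
  else th0.

Definition Tseq (k : nat) (w : Omega) : R := (phi k (theta k w, S k w)).1.

Definition Rseq (k : nat) (w : Omega) : R := (phi k (theta k w, S k w)).2.

(* The expectations are finite for the systems considered, so fine is
   harmless. *)
Definition ratio_of_averages (K : nat) : R :=
  (\sum_(k < K) fine ('E_P[Rseq k])%E) / (\sum_(k < K) fine ('E_P[Tseq k])%E).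

End Algorithm.

End Renewal.

(* Main.v *)
(* For fixed theta let t(theta) and r(theta) be the mean duration and reward of
   the greedy decision at theta. Since the greedy decision maximizes r - theta t
   pointwise, comparing it with one-shot policies of ratio close to
   the optimal ratio ths and using r <= ths t gives
     (theta - ths) (r(theta) - theta t(theta)) <= - Tmin (theta - ths)^2,
     |r(theta) - ths t(theta)| <= sqrt (2 C1) |theta - ths|.
   As theta[k] depends on S[0], ..., S[k-1] only, both bounds may be averaged
   over theta[k]. The first one makes a_k = E[(theta[k] - ths)^2] satisfy
     a_(k+1) <= (1 - 2/(k+2)) a_k + (2b/Tmin^2)/(k+2)^2,
   whence k a_k <= 2b/Tmin^2; the second one bounds
   |E[R[k]] - ths E[T[k]]| by sqrt (2 C1 a_k), and summing over k < K and
   dividing by sum_k E[T[k]] >= K Tmin gives the result. *)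

Require Import Defs.
From mathcomp Require Import all_boot all_order all_algebra ring lra.
From mathcomp Require Import finmap measurable_realfun.
From mathcomp Require Import all_classical all_reals all_analysis.
Set Implicit Arguments.
Unset Strict Implicit.
Unset Printing Implicit Defensive.
Import Order.TTheory GRing.Theory Num.Theory.
Import numFieldNormedType.Exports.
Local Open Scope classical_set_scope.
Local Open Scope ring_scope.

(** * Measurability of compact sets of the plane *)

(* [R * R] carries the product sigma-algebra, which is not the Borel one by
   definition; second countability identifies the two. *)
Lemma open_prod_measurable (R : realType) (O : set (R * R)) :
  open O -> measurable O.
Proof.
move=> oO.
pose box (q : rat * rat * nat) : set (R * R) :=
  ball (ratr q.1.1 : R) q.2.+1%:R^-1 `*` ball (ratr q.1.2 : R) q.2.+1%:R^-1.
(* Boxes not contained in [O] are replaced by the empty set, so the union runs over the whole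
   countable type of rational centres and radii 1/(n+1). *)
have -> : O = \bigcup_q (if `[< box q `<=` O >] then box q else set0).
  apply/seteqP; split=> [x Ox|x [q _]]; last by case: asboolP => // + xq; exact.
  have /nbhs_ballP[e /= e0 xeO] : nbhs x O by exact: open_nbhs_nbhs.
  have [n ne] : exists n, n.+1%:R^-1 < e / 2 :> R.
    have : 0 < e / 2 by rewrite divr_gt0.
    by move=> /ltr_add_invr[n]; rewrite add0r; exists n.
  have rat_near (y : R) : exists a : rat, ball (ratr a : R) n.+1%:R^-1 y.
    have [|a] := @rat_in_itvoo R (y - n.+1%:R^-1) (y + n.+1%:R^-1).
      by rewrite ltrD2l gtrN // invr_gt0.
    rewrite in_itv/= => /andP[ya1 ya2]; exists a; rewrite /ball/= ltr_norml.
    by rewrite ltrBrDr addrC ya1 ltrBlDl.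
  have [a xa] := rat_near x.1; have [b xb] := rat_near x.2.
  exists (a, b, n) => //; case: asboolP => // -[].
  by move=> y [ya yb]; apply: xeO; split;
    [apply: (@ball_splitr _ _ (ratr a : R)) | apply: (@ball_splitr _ _ (ratr b : R))];
    exact: (le_ball (ltW ne)).
apply: countable_bigcupT_measurable => [|q]; first exact: countableP.
by case: asboolP => // _; apply: measurableX; rewrite ball_itv.
Qed.

Lemma prod_hausdorff (T U : topologicalType) :
  hausdorff_space T -> hausdorff_space U -> hausdorff_space (T * U)%type.
Proof.
move=> hT hU [p1 p2] [q1 q2] pq; congr pair.
  apply: hT => A B pA qB.
  have [||[x y] [/= Ax Bx]] := pq (fst @^-1` A) (fst @^-1` B); last by exists x.
    exact: (@cvg_fst _ _ (nbhs p1) (nbhs p2)).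
  exact: (@cvg_fst _ _ (nbhs q1) (nbhs q2)).
apply: hU => A B pA qB.
have [||[x y] [/= Ax Bx]] := pq (snd @^-1` A) (snd @^-1` B); last by exists y.
  exact: (@cvg_snd _ _ (nbhs p1) (nbhs p2)).
exact: (@cvg_snd _ _ (nbhs q1) (nbhs q2)).
Qed.

(** Makes each decision set [D s] measurable, so that integrals against [kappa s] can be restricted
    to it. *)
Lemma compact_prod_measurable (R : realType) (K : set (R * R)) :
  compact K -> measurable K.
Proof.
move=> cK; have clK : closed K.
  by apply: compact_closed cK; apply: prod_hausdorff; exact: Rhausdorff.
rewrite -[K]setCK; apply: measurableC; apply: open_prod_measurable.
exact: closed_openC.
Qed.

(** * Sum of inverse square roots *)

(** With u^2 = n+1 and v^2 = n+2, the identity (v - u)(v + u) = 1 and u <= v give 1/v <= 2(v - u),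
    which telescopes. The constant -1, with equality for a single term, is the source of the term
    -sqrt(2b) in the theorem. *)
Lemma sum_rsqrt_le (R : realType) (n : nat) :
  \sum_(i < n.+1) (Num.sqrt i.+1%:R)^-1 <= 2 * Num.sqrt n.+1%:R - 1 :> R.
Proof.
elim: n => [|n IHn]; first by rewrite big_ord1 sqrtr1 invr1; lra.
rewrite big_ord_recr/=; apply: le_trans (lerD IHn (lexx _)) _.
set u := Num.sqrt n.+1%:R; set v := Num.sqrt n.+2%:R.
have u0 : 0 < u by rewrite sqrtr_gt0.
have v0 : 0 < v by rewrite sqrtr_gt0.
have uv : u <= v by rewrite ler_wsqrtr ?ler_nat.
have vv : v ^+ 2 - u ^+ 2 = 1.
  by rewrite !sqr_sqrtr// -[n.+2]addn1 natrD; lra.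
suff : v^-1 <= 2 * (v - u) by lra.
rewrite -[v^-1]mul1r ler_pdivrMr//; nra.
Qed.

(** * Integrals against finite measures and measures of mass one *)

(** The function is dominated through |y| <= 1 + y^2, and constants are integrable for a finite
    measure. *)
Lemma integrable_of_sqr d (T : measurableType d) (R : realType)
    (mu : {measure set T -> \bar R}) (f : T -> R) :
  (mu setT < +oo)%E -> measurable_fun setT f ->
  (\int[mu]_x (f x ^+ 2)%:E < +oo)%E -> mu.-integrable setT (EFin \o f).
Proof.
move=> muT mf f2.
have isq : mu.-integrable setT (EFin \o (fun x => f x ^+ 2)).
  apply/integrableP; split.
    by apply/measurable_EFinP; exact: measurable_funX.
  by under eq_integral do rewrite /= ger0_norm ?sqr_ge0//.
have i1 : mu.-integrable setT (EFin \o cst (1 : R)).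
  apply/integrableP; split; first exact/measurable_EFinP.
  by under eq_integral do rewrite /= normr1; rewrite integral_cst// mul1e.
apply: le_integrable (integrableD measurableT i1 isq) => //.
  exact/measurable_EFinP.
move=> x _ /=; rewrite lee_fin [leRHS]ger0_norm ?addr_ge0 ?sqr_ge0//.
by rewrite ler_norml; apply/andP; split; nra.
Qed.

Section unit_mass.
Context d (T : measurableType d) (R : realType).
Variable mu : {measure set T -> \bar R}.
Hypothesis mu1 : mu setT = 1%E.

Lemma integrable_cst_unit_mass (c : R) : mu.-integrable setT (EFin \o cst c).
Proof.
apply/integrableP; split; first exact/measurable_EFinP.
under eq_integral do rewrite /=.
by rewrite integral_cst// mu1 mule1 ltry.
Qed.

Lemma Rintegral_cst_unit_mass (c : R) : \int[mu]_x c = c.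
Proof. by rewrite Rintegral_cst// mu1 mulr1. Qed.

(** Jensen's inequality for the square: with c the mean of [f], integrate 2 c f <= f^2 + c^2. *)
Lemma sqr_Rintegral_le (f : T -> R) :
  mu.-integrable setT (EFin \o f) ->
  mu.-integrable setT (EFin \o (fun x => f x ^+ 2)) ->
  (\int[mu]_x f x) ^+ 2 <= \int[mu]_x (f x ^+ 2).
Proof.
move=> if1 if2; set c := \int[mu]_x f x.
have ilin : mu.-integrable setT (EFin \o (fun x => 2 * c * f x)).
  exact: (integrableZl measurableT (2 * c) if1).
suff : 2 * c * c <= \int[mu]_x (f x ^+ 2) + c ^+ 2 by lra.
rewrite {2}/c -RintegralZl// -[c ^+ 2]Rintegral_cst_unit_mass.
rewrite -RintegralD//; last exact: integrable_cst_unit_mass.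
apply: le_Rintegral => //.
  exact: (integrableD measurableT if2 (integrable_cst_unit_mass _)).
by move=> x _; have := sqr_ge0 (f x - c); nra.
Qed.

Section concentrated.
Variable D : set T.
Hypotheses (mD : measurable D) (muD : mu D = 1%E).

Let muDC : mu (~` D) = 0%E.
Proof.
have muT : (mu setT < +oo)%E by rewrite mu1 ltry.
transitivity (mu setT - mu D)%E; last by rewrite mu1 muD subee.
by rewrite -setTD measureD// setTI.
Qed.

(** The complement of [D] is null, so a bound on [D] suffices. The main use is [mu] = [kappa s] with
    [D] = [D s], where decisions are bounded in terms of [M s]. *)
Lemma integrable_concentrated (f : T -> R) (c : R) :
  measurable_fun setT f -> (forall x, D x -> `|f x| <= c) ->
  mu.-integrable setT (EFin \o f).
Proof.
move=> mf fc; apply/integrableP; split; first exact/measurable_EFinP.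
have mnf : measurable_fun setT (fun x => `|(f x)%:E|%E).
  by apply: measurableT_comp => //; exact/measurable_EFinP.
rewrite (@ge0_negligible_integral _ _ _ mu _ (~` D))//; last exact: measurableC.
rewrite setTD setCK; apply: (@le_lt_trans _ _ (\int[mu]_(x in D) c%:E)%E).
  by apply: ge0_le_integral => //; exact: measurable_funTS.
by rewrite integral_cst// muD mule1 ltry.
Qed.

Lemma Rintegral_concentrated_le (f : T -> R) (c : R) :
  mu.-integrable setT (EFin \o f) -> (forall x, D x -> f x <= c) ->
  \int[mu]_x f x <= c.
Proof.
move=> fint fc; have fD : mu.-integrable D (EFin \o f).
  exact: integrableS fint.
have cD : mu.-integrable D (EFin \o cst c).
  exact: integrableS (integrable_cst_unit_mass _).
rewrite /Rintegral (@negligible_integral _ _ _ mu _ (~` D))//; last exact: measurableC.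
rewrite setTD setCK; have -> : c = \int[mu]_(x in D) c.
  by rewrite Rintegral_cst// muD mulr1.
exact: le_Rintegral.
Qed.

End concentrated.
End unit_mass.

(** * Integrals of a kernel evaluated at a random state *)

Lemma measurable_kernel_integral d1 d2 d3 (Omega : measurableType d1)
    (X : measurableType d2) (Y : measurableType d3) (R : realType)
    (kappa : R.-ker X ~> Y) (S : Omega -> X) (g : Y -> \bar R) :
  measurable_fun setT S -> (forall y, 0 <= g y)%E -> measurable_fun setT g ->
  measurable_fun setT (fun w => \int[kappa (S w)]_y g y)%E.
Proof.
move=> mS g0 mg; apply: (@measurableT_comp _ _ _ _ _ _
  (fun s => \int[kappa s]_y g y)%E) => //.
by apply: measurable_fun_integral_kernel => //; exact: measurable_kernel.
Qed.

Lemma kernel_integral_integrable d1 d2 d3 (Omega : measurableType d1)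
    (X : measurableType d2) (Y : measurableType d3) (R : realType)
    (P : {measure set Omega -> \bar R}) (kappa : R.-ker X ~> Y)
    (S : Omega -> X) (f : Y -> \bar R) :
  measurable_fun setT S -> measurable_fun setT f ->
  (\int[P]_w \int[kappa (S w)]_y `|f y| < +oo)%E ->
  P.-integrable setT (fun w => \int[kappa (S w)]_y f y)%E.
Proof.
move=> mS mf foo.
have mabs : measurable_fun setT (fun y => `|f y|%E) by exact: measurableT_comp.
have mint : measurable_fun setT (fun w => \int[kappa (S w)]_y f y)%E.
  (* Measurability of kernel integrals is available for nonnegative integrands, hence the split into
     positive and negative parts. *)
  under eq_fun do rewrite integralE.
  apply: emeasurable_funB; apply: measurable_kernel_integral => //.
    exact: measurable_funepos.
  exact: measurable_funeneg.
apply/integrableP; split => //; apply: le_lt_trans foo.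
apply: ge0_le_integral => //.
- exact: measurableT_comp.

- exact: measurable_kernel_integral.
- by move=> w _; exact: le_abse_integral.
Qed.

(** The domination |y| <= 1 + y^2 is applied under each kernel measure, where the constant 1
    integrates to 1 because the kernel is a probability kernel, and then integrated against [P]. *)
Lemma kernel_integral_integrable_sqr d1 d2 d3 (Omega : measurableType d1)
    (X : measurableType d2) (Y : measurableType d3) (R : realType)
    (P : {measure set Omega -> \bar R}) (kappa : R.-pker X ~> Y)
    (S : Omega -> X) (f : Y -> R) :
  P setT = 1%E -> measurable_fun setT S -> measurable_fun setT f ->
  (\int[P]_w \int[kappa (S w)]_y (f y ^+ 2)%:E < +oo)%E ->
  P.-integrable setT (fun w => \int[kappa (S w)]_y (f y)%:E)%E.
Proof.
move=> P1 mS mf f2; apply: kernel_integral_integrable => //.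
  exact/measurable_EFinP.
have msq : measurable_fun setT (fun y => (f y ^+ 2)%:E).
  by apply/measurable_EFinP; exact: measurable_funX.
have mabs : measurable_fun setT (fun y => `|(f y)%:E|%E).
  by apply: measurableT_comp => //; exact/measurable_EFinP.
have sq0 y : (0 <= (f y ^+ 2)%:E)%E by rewrite lee_fin sqr_ge0.
apply: (@le_lt_trans _ _ (\int[P]_w (1 + \int[kappa (S w)]_y (f y ^+ 2)%:E))%E).
  apply: ge0_le_integral => //.
  - by move=> w _; exact: integral_ge0.
  - exact: measurable_kernel_integral.
  - by apply: emeasurable_funD => //; exact: measurable_kernel_integral.
  - move=> w _.
    have -> : (1 = \int[kappa (S w)]_y (cst 1 y) :> \bar R)%E.
      by rewrite integral_cst// mul1e prob_kernel.
    rewrite -ge0_integralD//.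
    apply: ge0_le_integral => //.
      exact: emeasurable_funD.
    move=> y _ /=; rewrite lee_fin.
    by rewrite ler_norml; apply/andP; split; nra.
rewrite ge0_integralD//.
- by rewrite integral_cst// mul1e P1 lte_add_pinfty// ltry.
- by move=> w _; exact: integral_ge0.
- exact: measurable_kernel_integral.
Qed.

(** * One-shot expectations and greedy decisions *)

Section one_shot.
Context {d : measure_display} {Omega : measurableType d} {R : realType} {m : nat}.
Variables (P : probability Omega R) (OmegaS : set (m.-tuple R))
  (D : m.-tuple R -> set (R * R)) (S : nat -> Omega -> m.-tuple R)
  (L M : m.-tuple R -> R) (Tmin Tmax Rmin Rmax C1 C2 thmin thmax : R)
  (phi : nat -> R * m.-tuple R -> R * R).
Hypotheses (HS : renewal_system P OmegaS D S L M)
  (HM : moment_bounds P OmegaS D S Tmin Tmax Rmin Rmax C1 C2)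
  (HG : greedy_rule OmegaS D thmin thmax phi).

Let P1 : P setT = 1%E. Proof. exact: probability_setT. Qed.

Lemma measurable_state k : measurable_fun setT (S k).
Proof. by case: HS => -[[]]. Qed.

Lemma state_mem k w : OmegaS (S k w).
Proof. by case: HS => -[]. Qed.

Lemma mean_sqr_lty k (kappa : R.-pker (m.-tuple R) ~> (R * R)%type) :
  admissible OmegaS D kappa ->
  (policy_mean P S kappa k (fun x => x.1 ^+ 2)%R < +oo)%E /\
  (policy_mean P S kappa k (fun x => x.2 ^+ 2)%R < +oo)%E.
Proof.
by move=> /(HM k)[_ _ h1 h2]; split; [apply: le_lt_trans h1 _|apply: le_lt_trans h2 _];
  rewrite ltry.
Qed.

(** For every state, the bound t^2 + r^2 <= [M] on the decision set makes |t|, |r| and t^2 at most 1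
    + [M]. Holding at each [w], this makes all conditional means finite. *)
Lemma decision_integrable k (kappa : R.-pker (m.-tuple R) ~> (R * R)%type) w :
  admissible OmegaS D kappa ->
  [/\ (kappa (S k w)).-integrable setT (EFin \o fst),
      (kappa (S k w)).-integrable setT (EFin \o snd) &
      (kappa (S k w)).-integrable setT (EFin \o (fun x => x.1 ^+ 2))].
Proof.
move=> akappa; have [_ HD HLM _ _] := HS.
have Sw := state_mem k w.
have mD : measurable (D (S k w)) by apply: compact_prod_measurable; case: (HD _ Sw).
have DM x : D (S k w) x -> x.1 ^+ 2 + x.2 ^+ 2 <= M (S k w).
  by case: (HLM _ Sw) => _ _ /(_ x) h /h[].
have kD := akappa _ Sw; have k1 := prob_kernel (s := kappa) (S k w).
split; apply: (@integrable_concentrated _ _ _ _ k1 _ mD kD _ (1 + M (S k w))) => //.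
- by move=> x /DM Dx; rewrite ler_norml; apply/andP; split; nra.
- by move=> x /DM Dx; rewrite ler_norml; apply/andP; split; nra.
- exact: measurable_funX.
- by move=> x /DM Dx; rewrite ler_norml; apply/andP; split; nra.
Qed.

(** The rule of frame [k] at a deterministic parameter, applied to the state of frame 0: since all
    states have the same law, this is what frame [k] sees once theta[k] is frozen. *)
Let dec k th w := phi k (th, S 0%N w).

Lemma measurable_section k th : measurable_fun setT (fun s => phi k (th, s)).
Proof. by have [mphi _] := HG k; exact: measurableT_comp. Qed.

Lemma measurable_dec k th : measurable_fun setT (dec k th).
Proof. exact: measurableT_comp (measurable_section k th) (measurable_state 0). Qed.

(** A greedy rule at a frozen parameter is a deterministic policy, that is, a Dirac kernel. It is
    admissible, so the uniform moment bounds apply to it and its means form a one-shot pair. *)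
Lemma dec_moments k th : thmin <= th <= thmax ->
  [/\ (Tmin%:E <= \int[P]_w (dec k th w).1%:E <= Tmax%:E)%E,
      (Rmin%:E <= \int[P]_w (dec k th w).2%:E <= Rmax%:E)%E,
      (\int[P]_w ((dec k th w).1 ^+ 2)%:E <= C1%:E)%E,
      (\int[P]_w ((dec k th w).2 ^+ 2)%:E <= C2%:E)%E &
   forall p : R * R, (\int[P]_w (dec k th w).1%:E = p.1%:E)%E ->
    (\int[P]_w (dec k th w).2%:E = p.2%:E)%E -> one_shot_means P OmegaS D S p].
Proof.
move=> thI; pose kappa : R.-pker (m.-tuple R) ~> (R * R)%type :=
  kdirac (measurable_section k th).
have akappa : admissible OmegaS D kappa.
  move=> s Os; rewrite /kappa /kdirac/= diracE mem_set//.
  by have [_ /(_ th s thI Os)[]] := HG k.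
have meanE (f : R * R -> R) : measurable_fun setT f ->
    policy_mean P S kappa 0 f = (\int[P]_w (f (dec k th w))%:E)%E.
  move=> mf; apply: eq_integral => w _; rewrite integral_dirac// ?diracT ?mul1e//.
  exact/measurable_EFinP.
have [] := HM 0%N akappa;
  rewrite !meanE; [|exact: measurable_funX..|exact: measurable_snd|exact: measurable_fst].
by move=> ? ? ? ?; split => // p p1 p2; exists kappa => //;
  rewrite !meanE; [|exact: measurable_snd|exact: measurable_fst].
Qed.

Lemma dec_integrable k th : thmin <= th <= thmax ->
  [/\ P.-integrable setT (fun w => (dec k th w).1%:E),
      P.-integrable setT (fun w => (dec k th w).2%:E) &
      P.-integrable setT (fun w => ((dec k th w).1 ^+ 2)%:E)].
Proof.
move=> thI; have [_ _ h1 h2 _] := dec_moments k thI.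
have mdec := measurable_dec k th.
have m1 : measurable_fun setT (fun w => (dec k th w).1) by exact: measurableT_comp.
have m2 : measurable_fun setT (fun w => (dec k th w).2) by exact: measurableT_comp.
have PT : (P setT < +oo)%E by rewrite P1 ltry.
split.
- by apply: (integrable_of_sqr PT m1); rewrite (le_lt_trans h1)// ltry.
- by apply: (integrable_of_sqr PT m2); rewrite (le_lt_trans h2)// ltry.
- apply/integrableP; split; first by apply/measurable_EFinP; exact: measurable_funX.
  under eq_integral do rewrite /= ger0_norm ?sqr_ge0//.
  by rewrite (le_lt_trans h1)// ltry.
Qed.

(** The functions t(theta) and r(theta); the index [k] only selects the tie-breaking rule. *)
Definition mean_time k th : R := \int[P]_w (dec k th w).1.
Definition mean_reward k th : R := \int[P]_w (dec k th w).2.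

Lemma mean_decE k th : thmin <= th <= thmax ->
  (\int[P]_w (dec k th w).1%:E = (mean_time k th)%:E)%E /\
  (\int[P]_w (dec k th w).2%:E = (mean_reward k th)%:E)%E.
Proof.
move=> thI; have [i1 i2 _] := dec_integrable k thI.
by rewrite /mean_time /mean_reward !fineK//; exact: integrable_fin_num.
Qed.

Lemma mean_time_bounds k th : thmin <= th <= thmax ->
  Tmin <= mean_time k th /\ mean_time k th ^+ 2 <= C1.
Proof.
move=> thI; have [h1 _ h2 _ _] := dec_moments k thI.
have [i1 _ isq] := dec_integrable k thI; have [e1 _] := mean_decE k thI.
split; first by move: h1; rewrite e1 lee_fin => /andP[].
apply: le_trans (sqr_Rintegral_le P1 i1 isq) _.
by rewrite -lee_fin fineK//; exact: integrable_fin_num.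
Qed.

Lemma mean_dec_one_shot k th : thmin <= th <= thmax ->
  one_shot_means P OmegaS D S (mean_time k th, mean_reward k th).
Proof.
by move=> thI; have [_ _ _ _] := dec_moments k thI; apply; have [] := mean_decE k thI.
Qed.

(** Everything is obtained by conditioning on the state. The bound on [p.1 ^+ 2] is Jensen's
    inequality, once under the kernel and once under [P]; the last clause integrates the pointwise
    optimality of the greedy decision, first over the kernel and then over the states. *)
Lemma one_shot_bounds (p : R * R) : one_shot_means P OmegaS D S p ->
  [/\ Tmin <= p.1, p.1 ^+ 2 <= C1, p.2 <= Rmax &
    forall k th, thmin <= th <= thmax ->
      p.2 - th * p.1 <= mean_reward k th - th * mean_time k th].
Proof.
move=> [kappa akappa [p1 p2]]; have [+ + c1 _] := HM 0%N akappa.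
rewrite p1 p2 !lee_fin => /andP[tp1 _] /andP[_ rp2].
have [l1 l2] := mean_sqr_lty 0 akappa; have mS := measurable_state 0.
have mi1 : P.-integrable setT (fun w => \int[kappa (S 0%N w)]_x (x.1)%:E)%E.
  exact: kernel_integral_integrable_sqr.
have mi2 : P.-integrable setT (fun w => \int[kappa (S 0%N w)]_x (x.2)%:E)%E.
  exact: kernel_integral_integrable_sqr.
(* Conditional means of the decision given the state, as real numbers. *)
pose i1 w := \int[kappa (S 0%N w)]_x (x.1 : R).
pose i2 w := \int[kappa (S 0%N w)]_x (x.2 : R).
have e1 w : (\int[kappa (S 0%N w)]_x (x.1)%:E = (i1 w)%:E)%E.
  by rewrite fineK//; apply: integrable_fin_num => //;
    case: (decision_integrable 0 w akappa).
have e2 w : (\int[kappa (S 0%N w)]_x (x.2)%:E = (i2 w)%:E)%E.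
  by rewrite fineK//; apply: integrable_fin_num => //;
    case: (decision_integrable 0 w akappa).
have {}mi1 : P.-integrable setT (EFin \o i1) by apply: eq_integrable mi1 => // w _.
have {}mi2 : P.-integrable setT (EFin \o i2) by apply: eq_integrable mi2 => // w _.
have {}p1 : p.1 = \int[P]_w i1 w.
  by rewrite /Rintegral; under eq_integral do rewrite -e1; rewrite [X in fine X]p1.
have {}p2 : p.2 = \int[P]_w i2 w.
  by rewrite /Rintegral; under eq_integral do rewrite -e2; rewrite [X in fine X]p2.
have i1sq w : i1 w ^+ 2 <= \int[kappa (S 0%N w)]_x (x.1 ^+ 2).
  have [k1 _ ksq] := decision_integrable 0 w akappa.
  by apply: (@sqr_Rintegral_le _ _ _ (kappa (S 0%N w))) => //; exact: prob_kernel.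
have sqP : (\int[P]_w (i1 w ^+ 2)%:E <= C1%:E)%E.
  apply: le_trans c1; apply: ge0_le_integral => //.
  - by move=> w _; rewrite lee_fin sqr_ge0.
  - apply/measurable_EFinP; apply: measurable_funX.
    by apply/measurable_EFinP; exact: measurable_int mi1.
  - apply: measurable_kernel_integral => //.
      by move=> y; rewrite lee_fin sqr_ge0.
    by apply/measurable_EFinP; exact: measurable_funX.
  - move=> w _; have [_ _ ksq] := decision_integrable 0 w akappa.
    rewrite -[leRHS]fineK ?lee_fin; first exact: i1sq.
    exact: integrable_fin_num.
split => //.
  have isq : P.-integrable setT (EFin \o (fun w => i1 w ^+ 2)).
    apply/integrableP; split.
      apply/measurable_EFinP; apply: measurable_funX.
      by apply/measurable_EFinP; exact: measurable_int mi1.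
    under eq_integral do rewrite /= ger0_norm ?sqr_ge0//.
    by rewrite (le_lt_trans sqP)// ltry.
  rewrite p1 (le_trans (sqr_Rintegral_le P1 mi1 isq))// -lee_fin fineK//.
  exact: integrable_fin_num.
move=> k th thI; have [j1 j2 _] := dec_integrable k thI.
have ji1 := integrableZl measurableT th j1.
have mii1 := integrableZl measurableT th mi1.
rewrite p1 p2 /mean_reward /mean_time -!RintegralZl// -!RintegralB//.
apply: le_Rintegral => //.
- exact: (integrableB measurableT mi2 mii1).
- exact: (integrableB measurableT j2 ji1).
(* Given the state, the policy is concentrated on the decision set, where [x.2 - th * x.1] is at
   most its value at the greedy decision. *)
move=> w _; have [k1 k2 _] := decision_integrable 0 w akappa.
have kth := integrableZl measurableT th k1.
rewrite /i1 /i2 -RintegralZl// -RintegralB//.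
have Sw := state_mem 0 w.
apply: (@Rintegral_concentrated_le _ _ _ _ _ (D (S 0%N w))).
- exact: prob_kernel.
- by apply: compact_prod_measurable; have [_ /(_ _ Sw)[]] := HS.
- exact: akappa.
- exact: (integrableB measurableT k2 kth).
- by have [_ /(_ th _ thI Sw)[_]] := HG k.
Qed.

End one_shot.

(** * The optimal ratio, drift and gap at a fixed parameter *)

(** An open half-plane containing a point of the closure meets the set. This carries linear
    inequalities from one-shot pairs to their closure, and brings near-optimal points of the closure
    back to one-shot pairs. *)
Lemma closure_halfplane (R : realType) (A : set (R * R)) (q : R * R) (a b c : R) :
  closure A q -> c < a * q.1 + b * q.2 ->
  exists2 p, A p & c < a * p.1 + b * p.2.
Proof.
move=> clAq cq.
have cont : (fun x : R * R => a * x.1 + b * x.2) x @[x --> q] --> a * q.1 + b * q.2.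
  by apply: cvgD; apply: cvgMr; [exact: cvg_fst|exact: cvg_snd].
by have [p [Ap pc]] := clAq _ (cvgr_gt _ cont _ cq); exists p.
Qed.

Section optimal_ratio.
Context {d : measure_display} {Omega : measurableType d} {R : realType} {m : nat}.
Variables (P : probability Omega R) (OmegaS : set (m.-tuple R))
  (D : m.-tuple R -> set (R * R)) (S : nat -> Omega -> m.-tuple R)
  (L M : m.-tuple R -> R) (Tmin Tmax Rmin Rmax C1 C2 thmin thmax : R)
  (phi : nat -> R * m.-tuple R -> R * R).
Hypotheses (HS : renewal_system P OmegaS D S L M) (Tmin0 : 0 < Tmin)
  (HM : moment_bounds P OmegaS D S Tmin Tmax Rmin Rmax C1 C2)
  (HG : greedy_rule OmegaS D thmin thmax phi).
Let ths := optimal_ratio P OmegaS D S.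
Let t_ := mean_time P S phi.
Let r_ := mean_reward P S phi.
Let A := one_shot_means P OmegaS D S.

Let bounds p : A p -> _ := one_shot_bounds HS HM HG (p := p).

Lemma closure_one_shot_bounds q : closure A q -> Tmin <= q.1 /\ q.2 <= Rmax.
Proof.
move=> clAq; split; rewrite leNgt; apply/negP => qlt.
  have [|p /bounds[Tp _ _ _]] := closure_halfplane (a := -1) (b := 0) (c := - Tmin) clAq.
    by lra.
  by lra.
have [|p /bounds[_ _ pR _]] := closure_halfplane (a := 0) (b := 1) (c := Rmax) clAq.
  by lra.
by lra.
Qed.

Hypothesis ths_itv : thmin <= ths <= thmax.

(* Rules out the junk value of [sup]. *)
Lemma has_sup_ratio : has_sup [set p.2 / p.1 | p in closure A].
Proof.
split.
  (* The greedy pair at parameter [ths] is a witness, because [ths] lies in the projection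
     interval. *)
  exists (r_ 0%N ths / t_ 0%N ths), (t_ 0%N ths, r_ 0%N ths) => //.
  apply: subset_closure; exact: (mean_dec_one_shot HS HM HG).
(* The absolute value covers a negative [Rmax], for which [Rmax / Tmin] need not bound the
   ratios. *)
exists (`|Rmax| / Tmin) => _ [[q1 q2] /closure_one_shot_bounds[/= Tq qR] <-].
have q0 : 0 < q1 := lt_le_trans Tmin0 Tq.
have cR : Rmax <= `|Rmax| by exact: ler_norm.
rewrite ler_pdivrMr// mulrAC ler_pdivlMr//.
by apply: (@le_trans _ _ (`|Rmax| * Tmin)); rewrite ?ler_wpM2l// ler_pM2r//; lra.
Qed.

Lemma one_shot_le_ratio p : A p -> p.2 <= ths * p.1.
Proof.
move=> Ap; have T0 := Tmin0; have [Tp _ _ _] := bounds Ap.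
rewrite -ler_pdivrMr; last by lra.
apply: (sup_upper_bound has_sup_ratio); exists p => //; exact: subset_closure.
Qed.

(** The supremum is taken over the closure: a point of the closure with ratio above [ths - e] is
    moved to a genuine one-shot pair through an open half-plane. *)
Lemma one_shot_near_ratio e : 0 < e -> exists2 p, A p & (ths - e) * p.1 < p.2.
Proof.
move=> e0; have [_ [[q1 q2] clAq <-] /= qe] := sup_adherent e0 has_sup_ratio.
have T0 := Tmin0; have [/= Tq _] := closure_one_shot_bounds clAq.
have {}qe : (ths - e) * q1 < q2 by rewrite -ltr_pdivlMr//; lra.
have [|p Ap pe] := closure_halfplane (a := - (ths - e)) (b := 1) (c := 0) clAq.
  by rewrite /=; lra.
by exists p => //; lra.
Qed.

Variables (k : nat) (th : R).
Hypothesis th_itv : thmin <= th <= thmax.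

Let t := t_ k th.
Let r := r_ k th.

Let t_bounds : Tmin <= t /\ t ^+ 2 <= C1.
Proof. exact (mean_time_bounds HS HM HG k th_itv). Qed.

Let rt : r <= ths * t.
Proof. exact: one_shot_le_ratio (mean_dec_one_shot HS HM HG k th_itv). Qed.

(** Supplies a competitor that the greedy pair beats at parameter [th], although its own ratio
    almost attains [ths]. *)
Let near_ratio e : 0 < e ->
  exists p, [/\ Tmin <= p.1, p.1 ^+ 2 <= C1, p.2 - th * p.1 <= r - th * t &
    ths * p.1 - e < p.2].
Proof.
move=> e0; have [_ tC] := t_bounds.
have C10 : 0 < 1 + C1 by have := sqr_ge0 t; lra.
(* Dividing by 1 + C1 turns the relative error into an absolute one, since p.1 <= 1 + p.1^2 <= 1 +
   C1. *)
have [p Ap pe] := one_shot_near_ratio (divr_gt0 e0 C10).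
have [Tp pC _ /(_ k th th_itv) pr] := bounds Ap; exists p; split=> //.
have : e / (1 + C1) * p.1 <= e.
  by rewrite mulrAC ler_pdivrMr// ler_wpM2l// ?ltW//; nra.
by move: pe; rewrite mulrBl; lra.
Qed.

(** If th >= ths, then r <= ths t gives r - th t <= -(th - ths) t, and t >= Tmin. If th < ths, the
    competitor gives r - th t >= (ths - th) Tmin - e, and e tends to 0. *)
Lemma mean_drift : (th - ths) * (r - th * t) <= - (Tmin * (th - ths) ^+ 2).
Proof.
have [Tt _] := t_bounds; have [le|lt] := leP ths th.
  have h1 : 0 <= (th - ths) * (ths * t - r) by rewrite mulr_ge0// subr_ge0.
  have h2 : 0 <= (th - ths) ^+ 2 * (t - Tmin).
    by rewrite mulr_ge0 ?sqr_ge0// subr_ge0.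
  nra.
suff : 0 <= (ths - th) * (r - th * t - (ths - th) * Tmin) by nra.
rewrite mulr_ge0 ?subr_ge0//; first exact: ltW.
apply/ler_addgt0Pr => e e0; have [p [Tp _ pr pe]] := near_ratio e0.
have : 0 <= (ths - th) * (p.1 - Tmin) by rewrite mulr_ge0 ?subr_ge0// ltW.
by nra.
Qed.

(** The upper side is r <= ths t. For the lower side the competitor gives ths t - r <= (ths - th)(t
    - p.1) + e. *)
Lemma mean_ratio_gap : `|r - ths * t| <= Num.sqrt (2 * C1) * `|th - ths|.
Proof.
have T0 := Tmin0; have [Tt tC] := t_bounds.
have c0 : 0 <= Num.sqrt (2 * C1) * `|th - ths| by rewrite mulr_ge0 ?sqrtr_ge0.
have rt' := rt; rewrite ler_norml; apply/andP; split; last by lra.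
rewrite lerNl; apply/ler_addgt0Pr => e e0.
have [p [Tp pC pr pe]] := near_ratio e0.
have : (ths - th) * (t - p.1) <= Num.sqrt (2 * C1) * `|th - ths|.
  rewrite (le_trans (ler_norm _))// normrM distrC mulrC ler_wpM2r//.
  rewrite -sqrtr_sqr ler_wsqrtr//.
  (* As t and p.1 are nonnegative, (t - p.1)^2 <= t^2 + p.1^2 <= 2 C1. *)
  have : 0 <= t * p.1 by rewrite mulr_ge0//; lra.
  nra.
nra.
Qed.

End optimal_ratio.

(** * Measures on a product determined by rectangles *)

(** Rectangles are stable under intersection and generate the product sigma-algebra; finiteness of
    [m1] lets the whole space serve as the exhausting sequence. *)
Lemma eq_measure_rectangles d1 d2 (Y : measurableType d1) (X : measurableType d2)
    (R : realType) (m1 m2 : {measure set (Y * X) -> \bar R}) :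
  (m1 setT < +oo)%E ->
  (forall A B, measurable A -> measurable B -> m1 (A `*` B) = m2 (A `*` B)) ->
  forall C, measurable C -> m1 C = m2 C.
Proof.
move=> m1oo m12 C mC.
pose G : set (set (Y * X)) :=
  [set C | exists A, measurable A /\ exists B, measurable B /\ C = A `*` B].
apply: (measure_unique G (fun=> setT)) => //.
- rewrite measurable_prod_measurableType//; congr (<<s _ >>).
  rewrite predeqE; split => [[A mA [B mB <-]]|[A [mA [B [mB ->]]]]].
    by exists A; split => //; exists B.
  by exists A => //; exists B.
- move=> _ _ [A1 [mA1 [B1 [mB1 ->]]]] [A2 [mA2 [B2 [mB2 ->]]]].
  rewrite -setXI; exists (A1 `&` A2); split; first exact: measurableI.
  by exists (B1 `&` B2); split => //; exact: measurableI.
- by move=> _; exists setT; split => //; exists setT; rewrite setXTT.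
- by rewrite bigcup_const.
- by move=> _ [A [mA [B [mB ->]]]]; exact: m12.
Qed.

(** Uniqueness on rectangles for two image measures. The source spaces may differ, as when [Omega]
    is compared with its square. *)
Lemma eq_pushforward_rectangles d1 d2 d3 d4 (T1 : measurableType d1)
    (T2 : measurableType d2) (Y : measurableType d3) (X : measurableType d4)
    (R : realType) (mu1 : {measure set T1 -> \bar R})
    (mu2 : {measure set T2 -> \bar R}) (h1 : T1 -> Y * X) (h2 : T2 -> Y * X) :
  measurable_fun setT h1 -> measurable_fun setT h2 -> (mu1 setT < +oo)%E ->
  (forall A B, measurable A -> measurable B ->
    mu1 (h1 @^-1` (A `*` B)) = mu2 (h2 @^-1` (A `*` B))) ->
  forall C, measurable C -> mu1 (h1 @^-1` C) = mu2 (h2 @^-1` C).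
Proof.
move=> mh1 mh2 mu1oo h12.
pose m1 : {measure set (Y * X) -> \bar R} :=
  measure_function_pushforward__canonical__measure_function_Measure mu1 mh1.
pose m2 : {measure set (Y * X) -> \bar R} :=
  measure_function_pushforward__canonical__measure_function_Measure mu2 mh2.
exact: (@eq_measure_rectangles _ _ _ _ _ m1 m2).
Qed.

(** * Independence of a driven chain from its current input *)

Section driven_chain.
Context {d d1 d2 : measure_display} {Omega : measurableType d}
  {Y : measurableType d1} {X : measurableType d2} {R : realType}.
Variables (P : probability Omega R) (S : nat -> Omega -> X)
  (g : nat -> Y * X -> Y) (y0 : Y) (st : nat -> Omega -> Y).
Hypotheses (HS : iid P S) (mg : forall k, measurable_fun setT (g k))
  (st0 : forall w, st 0%N w = y0)
  (stS : forall k w, st k.+1 w = g k (st k w, S k w)).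

Let mS k : measurable_fun setT (S k). Proof. by case: HS. Qed.

Lemma measurable_chain k : measurable_fun setT (st k).
Proof.
elim: k => [|k IHk]; first by rewrite (_ : st 0%N = cst y0)//; exact/funext.
rewrite (_ : st k.+1 = g k \o (fun w => (st k w, S k w))).
  by apply: measurableT_comp => //; exact: measurable_fun_pair.
exact/funext.
Qed.

Let cylinder (J : {fset nat}) (A : nat -> set X) :=
  \bigcap_(i in [set` J]) (S i @^-1` A i).

Let measurable_cylinder J A : (forall i, i \in J -> measurable (A i)) ->
  measurable (cylinder J A).
Proof.
move=> mA; apply: fin_bigcap_measurable; first exact: finite_fset.
by move=> i iJ; rewrite -[X in measurable X]setTI; exact: mS (mA _ iJ).
Qed.

Let cylinderU1 k J A B : k \notin J ->
  cylinder (k |` J)%fset (fun i => if i == k then B else A i) =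
  S k @^-1` B `&` cylinder J A.
Proof.
move=> kJ; rewrite /cylinder; apply/seteqP; split => w.
  move=> h; split; first by have := h k; rewrite /= !inE eqxx; exact.
  move=> i /= iJ; have := h i; rewrite /= !inE iJ orbT.
  by case: eqP => [ik|_]; [rewrite -ik iJ in kJ|exact].
move=> [wB h] i; rewrite /= !inE; case: eqP => [->//|_ /= iJ]; exact: h.
Qed.

Let prob_cylinderU1 k J A B : k \notin J ->
  (forall i, i \in J -> measurable (A i)) -> measurable B ->
  (P (S k @^-1` B `&` cylinder J A) = P (S k @^-1` B) * P (cylinder J A))%E.
Proof.
move=> kJ mA mB; have [_ indep _] := HS.
rewrite -cylinderU1// /cylinder !indep//; last first.
  by move=> i; rewrite !inE; case: eqP => //= _; exact: mA.
rewrite big_fsetU1//= eqxx; congr (_ * _)%E.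
by apply: eq_big_seq => i iJ; case: eqP => // ik; rewrite -ik iJ in kJ.
Qed.

Let cylinder0 A : cylinder fset0 A = setT.
Proof. by apply/seteqP; split=> w // _ i; rewrite /= inE. Qed.

(* The events on all the later inputs make the induction go through: st k.+1 is a
   function of (st k, S k), whose law given such an event is determined by the
   rectangles, where the induction hypothesis applies with S k moved into the
   event. *)
Lemma chain_indep_cylinder k J A B :
  (forall i, i \in J -> (k <= i)%N) -> (forall i, i \in J -> measurable (A i)) ->
  measurable B ->
  (P (st k @^-1` B `&` cylinder J A) = P (st k @^-1` B) * P (cylinder J A))%E.
Proof.
elim: k J A B => [|k IHk] J A B kJ mA mB.
  have -> : st 0%N @^-1` B = if `[< B y0 >] then setT else set0.
    by apply/seteqP; split=> w; rewrite /= st0; case: asboolP.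
  case: asboolP => _; first by rewrite setTI probability_setT mul1e.
  by rewrite set0I measure0 mul0e.
have mcyl := measurable_cylinder mA.
have kNJ : k \notin J by apply/negP => /kJ; rewrite ltnn.
pose h w := (st k w, S k w).
have mh : measurable_fun setT h.
  by apply: measurable_fun_pair => //; exact: measurable_chain.
have PF1 : 0 <= fine (P (cylinder J A)) by rewrite fine_ge0.
have -> : st k.+1 @^-1` B = h @^-1` (g k @^-1` B).
  by apply/seteqP; split => w /=; rewrite stS.
have mgB : measurable (g k @^-1` B) by rewrite -[X in measurable X]setTI; exact: mg.
have PFfin : P (cylinder J A) \is a fin_num by exact: fin_num_measure.
rewrite muleC -[in RHS](fineK PFfin).
(* Independence becomes an equality of laws of [h]: under [P] restricted to the cylinder, and under
   [P] multiplied by the probability of the cylinder. *)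
pose mu1 : {measure set Omega -> \bar R} := mrestr P mcyl.
pose mu2 : {measure set Omega -> \bar R} := mscale (NngNum PF1) P.
apply: (@eq_pushforward_rectangles _ _ _ _ _ _ _ _ _ mu1 mu2 h h) => //.
  by rewrite /mu1 /= /mrestr setTI -ge0_fin_numE.
move=> A1 B1 mA1 mB1; rewrite /mu1 /mu2 /= /mrestr /mscale /= fineK//.
have -> : h @^-1` (A1 `*` B1) = st k @^-1` A1 `&` S k @^-1` B1 by [].
have mA' i : i \in (k |` J)%fset -> measurable (if i == k then B1 else A i).
  by rewrite !inE; case: eqP => //= _; exact: mA.
have kJ' i : i \in (k |` J)%fset -> (k <= i)%N.
  by rewrite !inE => /orP[/eqP->//|/kJ/ltnW].
have := IHk _ _ _ kJ' mA' mA1; rewrite cylinderU1// setIA => ->.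
rewrite prob_cylinderU1// muleA muleC; congr (_ * _)%E.
(* The induction hypothesis is used a second time, on the index set reduced to [k], to factor the
   event on ([st k], [S k]) alone. *)
have k0 : k \notin fset0 by rewrite inE.
have := IHk (k |` fset0)%fset (fun i => if i == k then B1 else setT) A1.
rewrite (cylinderU1 (fun=> setT))// cylinder0 setIT => -> // i; rewrite !inE orbF.
  by move=> /eqP->.
by case: eqP.
Qed.

Lemma chain_indep k A B : measurable A -> measurable B ->
  (P (st k @^-1` A `&` S k @^-1` B) = P (st k @^-1` A) * P (S k @^-1` B))%E.
Proof.
move=> mA mB; have k0 : k \notin fset0 by rewrite inE.
have := chain_indep_cylinder (k := k) (J := (k |` fset0)%fset)
  (A := fun i => if i == k then B else setT) _ _ mA.
rewrite (cylinderU1 (fun=> setT))// cylinder0 setIT => -> // i; rewrite !inE orbF.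
  by move=> /eqP->.
by case: eqP.
Qed.

(** Model of the pair in which the chain and a fresh state live on separate copies of [Omega], hence
    are independent under the product measure. *)
Let joint k (x : Omega * Omega) := (st k x.1, S 0%N x.2).

Let measurable_joint k : measurable_fun setT (joint k).
Proof.
apply: measurable_fun_pair.
  exact: measurableT_comp (measurable_chain k) measurable_fst.
exact: measurableT_comp (mS 0) measurable_snd.
Qed.

Let diag k w := (st k w, S k w).

Let measurable_diag k : measurable_fun setT (diag k).
Proof. by apply: measurable_fun_pair => //; exact: measurable_chain. Qed.

(** On rectangles this is independence of [st k] and [S k], followed by replacing [S k] with [S 0],
    which has the same law. *)
Lemma chain_law k C : measurable C ->
  P (diag k @^-1` C) = (P \x P)%E (joint k @^-1` C).
Proof.
move=> mC; apply: (@eq_pushforward_rectangles _ _ _ _ _ _ _ _ _ P (P \x P)%E) => //.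
  by rewrite -ge0_fin_numE// fin_num_measure.
move=> A B mA mB.
have -> : joint k @^-1` (A `*` B) = (st k @^-1` A) `*` (S 0%N @^-1` B) by [].
rewrite /= product_measure1E; last 2 first.
- by rewrite -[X in measurable X]setTI; exact: measurable_chain.
- by rewrite -[X in measurable X]setTI; exact: mS.
have -> : diag k @^-1` (A `*` B) = st k @^-1` A `&` S k @^-1` B by [].
by rewrite chain_indep//; have [_ _ ->] := HS.
Qed.

(** Freezing principle: both sides are integrals of [f] against the common law of the pair, the
    right one by Tonelli's theorem. It plays the part of conditioning on theta[k]. *)
Lemma ge0_integral_chain k (f : Y * X -> \bar R) :
  measurable_fun setT f -> (forall x, 0 <= f x)%E ->
  (\int[P]_w f (st k w, S k w) = \int[P]_w \int[P]_v f (st k w, S 0%N v))%E.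
Proof.
move=> mf f0.
have := ge0_integral_pushforward (measurable_diag k) P measurableT mf (fun x _ => f0 x).
rewrite preimage_setT => <-.
have -> : (\int[P]_w \int[P]_v f (st k w, S 0%N v) =
  \int[P \x P]_x (f \o joint k) x)%E.
  by rewrite fubini_tonelli1//;
    [exact: measurableT_comp mf (measurable_joint k)|move=> x; exact: f0].
have := ge0_integral_pushforward (measurable_joint k) (P \x P)%E measurableT mf
  (fun x _ => f0 x).
rewrite preimage_setT => <-.
apply: eq_measure_integral => C mC _; exact: chain_law.
Qed.

(** The nonnegative case applied to |f| gives integrability on the product space, after which
    Fubini's theorem replaces Tonelli's. *)
Lemma integral_chain k (f : Y * X -> \bar R) :
  measurable_fun setT f -> P.-integrable setT (fun w => f (st k w, S k w)) ->
  P.-integrable setT (fun w => \int[P]_v f (st k w, S 0%N v))%E /\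
  (\int[P]_w f (st k w, S k w) = \int[P]_w \int[P]_v f (st k w, S 0%N v))%E.
Proof.
move=> mf iF.
have iJ : (P \x P)%E.-integrable setT (f \o joint k).
  apply/integrable12ltyP; first exact: measurableT_comp.
  have mabs : measurable_fun setT (abse \o f) by exact: measurableT_comp.
  have /integrableP[_] := iF.
  by rewrite (ge0_integral_chain k mabs (fun x => abse_ge0 _)).
split; first exact: integrable_fubini_F iJ.
have := @integral_pushforward _ _ _ _ _ _ (measurable_diag k) P _ _ mf iF measurableT.
rewrite preimage_setT => <-.
have := integral12_prod_meas1 iJ; rewrite /fubini_F => ->.
have := @integral_pushforward _ _ _ _ _ _ (measurable_joint k) (P \x P)%E _ _ mf iJ
  measurableT.
rewrite preimage_setT => <-.
apply: eq_measure_integral => C mC _; exact: chain_law.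
Qed.

(** Integrability of every section makes the inner integrals finite, so passing to real values loses
    nothing. *)
Lemma Rintegral_chain k (f : Y * X -> R) :
  measurable_fun setT f ->
  P.-integrable setT (EFin \o (fun w => f (st k w, S k w))) ->
  (forall w, P.-integrable setT (EFin \o (fun v => f (st k w, S 0%N v)))) ->
  P.-integrable setT (EFin \o (fun w => \int[P]_v f (st k w, S 0%N v))) /\
  \int[P]_w f (st k w, S k w) = \int[P]_w \int[P]_v f (st k w, S 0%N v).
Proof.
move=> mf iF iw; have mEf : measurable_fun setT (EFin \o f) by exact/measurable_EFinP.
have [iint eint] := integral_chain mEf iF.
have inner w : (\int[P]_v (EFin \o f) (st k w, S 0%N v))%E =
    (\int[P]_v f (st k w, S 0%N v))%:E.
  by rewrite fineK//; exact: integrable_fin_num (iw w).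
split; first by apply: eq_integrable iint => // w _; exact: inner.
rewrite [LHS]/Rintegral [X in fine X = _]eint; congr fine.
by apply: eq_integral => w _; exact: inner.
Qed.

End driven_chain.

(** * Mean-square dynamics of the parameter *)

Lemma sqr_proj_itv_le (R : realType) (lo hi c x : R) : lo <= c <= hi ->
  (proj_itv lo hi x - c) ^+ 2 <= (x - c) ^+ 2.
Proof.
move=> /andP[lc ch]; rewrite /proj_itv; case: (leP x hi) => xh.
  by case: (leP lo x) => lx //; nra.
by case: (leP lo hi) => lh; nra.
Qed.

Section dynamics.
Context {d : measure_display} {Omega : measurableType d} {R : realType} {m : nat}.
Variables (P : probability Omega R) (OmegaS : set (m.-tuple R))
  (D : m.-tuple R -> set (R * R)) (S : nat -> Omega -> m.-tuple R)
  (L M : m.-tuple R -> R) (Tmin Tmax Rmin Rmax C1 C2 thmin thmax th0 b : R)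
  (eta : nat -> R) (phi : nat -> R * m.-tuple R -> R * R).
Hypotheses (HS : renewal_system P OmegaS D S L M) (Tmin0 : 0 < Tmin)
  (HM : moment_bounds P OmegaS D S Tmin Tmax Rmin Rmax C1 C2)
  (HG : greedy_rule OmegaS D thmin thmax phi).
Let ths := optimal_ratio P OmegaS D S.
Let th_ := theta S thmin thmax th0 eta phi.
Let T_ := Tseq S thmin thmax th0 eta phi.
Let R_ := Rseq S thmin thmax th0 eta phi.
Hypotheses (ths_itv : thmin <= ths <= thmax) (th0_itv : thmin <= th0 <= thmax).
Hypothesis Hb : forall k,
  (\int[P]_w ((R_ k w - th_ k w * T_ k w) ^+ 2)%:E <= (2 * b)%:E)%E.

Let P1 : P setT = 1%E. Proof. exact: probability_setT. Qed.

Let PT : (P setT < +oo)%E. Proof. by rewrite P1 ltry. Qed.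

Lemma theta_itv k w : thmin <= th_ k w <= thmax.
Proof.
have /andP[h1 h2] := th0_itv.
case: k => [|k]; first exact: th0_itv.
rewrite /th_ /= /proj_itv le_max lexx/= ge_max ge_min lexx orbT andbT.
exact: le_trans h1 h2.
Qed.

(** Exhibits [theta] as a chain driven by the states, so that the freezing principle applies to
    it. *)
Let step k (x : R * m.-tuple R) : R :=
  proj_itv thmin thmax (x.1 + eta k * ((phi k x).2 - x.1 * (phi k x).1)).

Let mphi k : measurable_fun setT (phi k). Proof. by case: (HG k). Qed.

Let mphi1 k : measurable_fun setT (fun x => (phi k x).1).
Proof. exact: measurableT_comp. Qed.

Let mphi2 k : measurable_fun setT (fun x => (phi k x).2).
Proof. exact: measurableT_comp. Qed.

Let m_gain k :
  measurable_fun setT (fun x : R * m.-tuple R => (phi k x).2 - x.1 * (phi k x).1).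
Proof. by apply: measurable_funB => //; apply: measurable_funM. Qed.

Let measurable_step k : measurable_fun setT (step k).
Proof.
apply: measurable_maxr => //; apply: measurable_minr => //.
apply: measurable_funD => //; apply: measurable_funM => //; exact: m_gain.
Qed.

Let HI : iid P S. Proof. by case: HS => -[]. Qed.

Let thS k w : th_ k.+1 w = step k (th_ k w, S k w). Proof. by []. Qed.

Lemma measurable_theta k : measurable_fun setT (th_ k).
Proof. exact: (measurable_chain HI measurable_step (y0 := th0) _ thS). Qed.

Let measurable_T k : measurable_fun setT (T_ k).
Proof.
apply: (measurableT_comp (mphi1 k)); apply: measurable_fun_pair.
  exact: measurable_theta.
exact: (measurable_state HS).
Qed.

Let measurable_R k : measurable_fun setT (R_ k).
Proof.
apply: (measurableT_comp (mphi2 k)); apply: measurable_fun_pair.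
  exact: measurable_theta.
exact: (measurable_state HS).
Qed.

Let integral_freeze k (f : R * m.-tuple R -> \bar R) : measurable_fun setT f ->
  (forall x, 0 <= f x)%E ->
  (\int[P]_w f (th_ k w, S k w) = \int[P]_w \int[P]_v f (th_ k w, S 0%N v))%E.
Proof. exact: (ge0_integral_chain HI measurable_step (y0 := th0) _ thS). Qed.

(** A bound uniform over deterministic parameters applies to the random one after freezing, as
    theta[k] stays in the projection interval. *)
Let freeze_le k (f : R * m.-tuple R -> R) (c : R) : measurable_fun setT f ->
  (forall x, 0 <= f x) ->
  (forall th, thmin <= th <= thmax -> (\int[P]_v (f (th, S 0%N v))%:E <= c%:E)%E) ->
  (\int[P]_w (f (th_ k w, S k w))%:E < +oo)%E.
Proof.
move=> mf f0 fc; have mEf : measurable_fun setT (EFin \o f) by exact/measurable_EFinP.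
rewrite (integral_freeze k mEf); last by move=> x; rewrite lee_fin.
apply: (@le_lt_trans _ _ (\int[P]_w c%:E)%E); last first.
  by apply: integrable_lty => //; exact: integrable_cst_unit_mass.
have mF : measurable_fun setT (fun x : R * Omega => (f (x.1, S 0%N x.2))%:E).
  apply/measurable_EFinP; apply: (measurableT_comp mf).
  apply: measurable_fun_pair => //.
  exact: measurableT_comp (measurable_state HS 0) measurable_snd.
have mI : measurable_fun setT (fun y => \int[P]_v (f (y, S 0%N v))%:E)%E.
  apply: (@measurable_fun_fubini_tonelli_F _ _ _ _ _ P _ mF).
  by move=> x; rewrite lee_fin.
apply: ge0_le_integral => //.
- by move=> w _; apply: integral_ge0 => v _; rewrite lee_fin.
- exact: measurableT_comp mI (measurable_theta k).
- by move=> w _; apply: fc; exact: theta_itv.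
Qed.

Lemma time_integrable k : P.-integrable setT (EFin \o T_ k).
Proof.
apply: integrable_of_sqr => //.
apply: (freeze_le k (f := fun x => (phi k x).1 ^+ 2) (c := C1)).
- exact: measurable_funX.
- by move=> x; exact: sqr_ge0.
- by move=> th thI; have [] := dec_moments HM HG k thI.
Qed.

Lemma reward_integrable k : P.-integrable setT (EFin \o R_ k).
Proof.
apply: integrable_of_sqr => //.
apply: (freeze_le k (f := fun x => (phi k x).2 ^+ 2) (c := C2)).
- exact: measurable_funX.
- by move=> x; exact: sqr_ge0.
- by move=> th thI; have [] := dec_moments HM HG k thI.
Qed.

Lemma bounded_integrable (f : Omega -> R) (c : R) : measurable_fun setT f ->
  (forall w, `|f w| <= c) -> P.-integrable setT (EFin \o f).
Proof.
by move=> mf fc; apply: (integrable_concentrated P1 measurableT P1 mf (c := c)).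
Qed.

Let thmin_max : thmin <= thmax.
Proof. by have /andP[h1 h2] := th0_itv; exact: le_trans h1 h2. Qed.

Let dev_le k w : `|th_ k w - ths| <= thmax - thmin.
Proof.
have /andP[? ?] := theta_itv k w; have /andP[? ?] := ths_itv.
by rewrite ler_norml; apply/andP; split; lra.
Qed.

Let m_dev k : measurable_fun setT (fun w => th_ k w - ths).
Proof. by apply: measurable_funB => //; exact: measurable_theta. Qed.

Lemma dev_integrable k : P.-integrable setT (EFin \o (fun w => th_ k w - ths)).
Proof. exact: bounded_integrable (dev_le k). Qed.

Lemma dev_sqr_integrable k :
  P.-integrable setT (EFin \o (fun w => (th_ k w - ths) ^+ 2)).
Proof.
apply: (bounded_integrable (c := (thmax - thmin) ^+ 2)).
  exact: measurable_funX.
by move=> w; rewrite normrX lerXn2r ?nnegrE ?subr_ge0.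
Qed.

Let G k w := R_ k w - th_ k w * T_ k w.

Let mG k : measurable_fun setT (G k).
Proof.
apply: measurable_funB => //; apply: measurable_funM => //; exact: measurable_theta.
Qed.

Lemma gain_sqr_integrable k : P.-integrable setT (EFin \o (fun w => G k w ^+ 2)).
Proof.
apply/integrableP; split; first by apply/measurable_EFinP; exact: measurable_funX.
under eq_integral do rewrite /= ger0_norm ?sqr_ge0//.
by rewrite (le_lt_trans (Hb k))// ltry.
Qed.

Let gain_sqr_le k : \int[P]_w (G k w ^+ 2) <= 2 * b.
Proof.
rewrite -lee_fin fineK; first exact: Hb.
exact: integrable_fin_num (gain_sqr_integrable k).
Qed.

Lemma gain_integrable k : P.-integrable setT (EFin \o G k).
Proof.
apply: integrable_of_sqr => //; rewrite (le_lt_trans (Hb k))// ltry//.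
Qed.

Lemma dev_gain_integrable k :
  P.-integrable setT (EFin \o (fun w => (th_ k w - ths) * G k w)).
Proof.
have ig := integrableZl measurableT (thmax - thmin) (gain_integrable k).
apply: le_integrable ig => //.
  by apply/measurable_EFinP; exact: measurable_funM.
move=> w _; rewrite /= lee_fin !normrM ler_wpM2r//.
by rewrite (le_trans (dev_le k w))// ler_norm.
Qed.

(** The quantity a_k of the outline. *)
Definition mean_sqr_dev k : R := \int[P]_w ((th_ k w - ths) ^+ 2).

Let freeze k (f : R * m.-tuple R -> R) : measurable_fun setT f ->
  P.-integrable setT (EFin \o (fun w => f (th_ k w, S k w))) ->
  (forall w, P.-integrable setT (EFin \o (fun v => f (th_ k w, S 0%N v)))) ->
  P.-integrable setT (EFin \o (fun w => \int[P]_v f (th_ k w, S 0%N v))) /\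
  \int[P]_w f (th_ k w, S k w) = \int[P]_w \int[P]_v f (th_ k w, S 0%N v).
Proof. exact: (Rintegral_chain HI measurable_step (y0 := th0) _ thS). Qed.

(** Freezing theta[k] turns the inner integral into the left side of [mean_drift], which is then
    averaged over theta[k]. *)
Lemma mean_dev_gain_le k :
  \int[P]_w ((th_ k w - ths) * G k w) <= - (Tmin * mean_sqr_dev k).
Proof.
pose f (x : R * m.-tuple R) := (x.1 - ths) * ((phi k x).2 - x.1 * (phi k x).1).
have mf : measurable_fun setT f.
  apply: measurable_funM; first exact: measurable_funB.
  by apply: measurable_funB => //; exact: measurable_funM.
have inner w : P.-integrable setT (EFin \o (fun v => f (th_ k w, S 0%N v))) /\
    \int[P]_v f (th_ k w, S 0%N v) = (th_ k w - ths) *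
      (mean_reward P S phi k (th_ k w) - th_ k w * mean_time P S phi k (th_ k w)).
  have [j1 j2 _] := dec_integrable HS HM HG k (theta_itv k w).
  have jz := integrableZl measurableT (th_ k w) j1.
  have jd := integrableB measurableT j2 jz.
  split; first exact: (integrableZl measurableT (th_ k w - ths) jd).
  by rewrite /f/= RintegralZl// RintegralB// RintegralZl.
have [i1 e1] := freeze mf (dev_gain_integrable k) (fun w => (inner w).1).
rewrite [leLHS]e1 /mean_sqr_dev.
have idev := integrableZl measurableT (- Tmin) (dev_sqr_integrable k).
rewrite -mulNr -RintegralZl//; last exact: dev_sqr_integrable.
apply: le_Rintegral => //.
move=> w _; rewrite (inner w).2 mulNr.
exact (mean_drift HS Tmin0 HM HG ths_itv k (theta_itv k w)).
Qed.

(** Projection does not increase the distance to [ths]. Expanding the square leaves a cross term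
    controlled by the drift and a quadratic term controlled by [b]. *)
Lemma mean_sqr_dev_step k : 0 <= eta k ->
  mean_sqr_dev k.+1 <= (1 - 2 * eta k * Tmin) * mean_sqr_dev k + 2 * b * eta k ^+ 2.
Proof.
move=> eta0.
have idev := dev_sqr_integrable k.
have idg := integrableZl measurableT (2 * eta k) (dev_gain_integrable k).
have ig := integrableZl measurableT (eta k ^+ 2) (gain_sqr_integrable k).
have i12 := integrableD measurableT idev idg.
have : mean_sqr_dev k.+1 <= \int[P]_w ((th_ k w - ths) ^+ 2 +
    2 * eta k * ((th_ k w - ths) * G k w) + eta k ^+ 2 * G k w ^+ 2).
  apply: le_Rintegral => //.
  - exact: dev_sqr_integrable.
  - exact: (integrableD measurableT i12 ig).
  move=> w _; apply: (@le_trans _ _ ((th_ k w + eta k * G k w - ths) ^+ 2)); last first.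
    by rewrite le_eqVlt; apply/orP; left; apply/eqP; ring.
  exact: sqr_proj_itv_le.
rewrite RintegralD// RintegralD// RintegralZl//; last exact: dev_gain_integrable.
rewrite RintegralZl//; last exact: gain_sqr_integrable.
have := mean_dev_gain_le k; have := gain_sqr_le k; rewrite -/(mean_sqr_dev k).
have := sqr_ge0 (eta k).
nra.
Qed.

Lemma mean_time_ge k : Tmin <= \int[P]_w T_ k w.
Proof.
have inner w : P.-integrable setT (EFin \o (fun v => (phi k (th_ k w, S 0%N v)).1)).
  by have [] := dec_integrable HS HM HG k (theta_itv k w).
have [i1 e1] := freeze (mphi1 k) (time_integrable k) inner.
rewrite [leRHS]e1 -[leLHS](Rintegral_cst_unit_mass P1).
apply: le_Rintegral => //; first exact: integrable_cst_unit_mass.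
by move=> w _; have [] := mean_time_bounds HS HM HG k (theta_itv k w).
Qed.

(** The gap at a frozen parameter is averaged, and the mean of |theta[k] - ths| is bounded by the
    root of its mean square. *)
Lemma mean_gap_le k : `|\int[P]_w R_ k w - ths * \int[P]_w T_ k w| <=
  Num.sqrt (2 * C1) * Num.sqrt (mean_sqr_dev k).
Proof.
pose f (x : R * m.-tuple R) := (phi k x).2 - ths * (phi k x).1.
have mf : measurable_fun setT f.
  by apply: measurable_funB => //; exact: measurable_funM.
have inner w : P.-integrable setT (EFin \o (fun v => f (th_ k w, S 0%N v))) /\
    \int[P]_v f (th_ k w, S 0%N v) =
      mean_reward P S phi k (th_ k w) - ths * mean_time P S phi k (th_ k w).
  have [j1 j2 _] := dec_integrable HS HM HG k (theta_itv k w).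
  have jz := integrableZl measurableT ths j1.
  split; first exact: (integrableB measurableT j2 jz).
  by rewrite /f/= RintegralB// RintegralZl.
have iT := integrableZl measurableT ths (time_integrable k).
rewrite -RintegralZl//; last exact: time_integrable.
rewrite -RintegralB//; last exact: reward_integrable.
have [i1 e1] := freeze mf (integrableB measurableT (reward_integrable k) iT)
  (fun w => (inner w).1).
rewrite [X in `|X|]e1 (le_trans (le_normr_Rintegral _ _))//.
have idev := dev_integrable k.
have indev := integrable_norm idev.
have idz := integrableZl measurableT (Num.sqrt (2 * C1)) indev.
apply: (@le_trans _ _ (\int[P]_w (Num.sqrt (2 * C1) * `|th_ k w - ths|))).
  apply: le_Rintegral => //; first exact: integrable_norm.
  by move=> w _; rewrite (inner w).2;
    exact (mean_ratio_gap HS Tmin0 HM HG ths_itv k (theta_itv k w)).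
rewrite RintegralZl// ler_wpM2l ?sqrtr_ge0//.
have n0 : 0 <= \int[P]_w `|th_ k w - ths| by exact: Rintegral_ge0.
rewrite -[leLHS]ger0_norm// -sqrtr_sqr ler_wsqrtr//.
have isq : P.-integrable setT (EFin \o (fun w => `|th_ k w - ths| ^+ 2)).
  by apply: eq_integrable (dev_sqr_integrable k) => // w _;
    rewrite /= real_normK// num_real.
rewrite (le_trans (sqr_Rintegral_le P1 indev isq))//.
by under eq_Rintegral do rewrite real_normK ?num_real//.
Qed.

End dynamics.

(** * Rates for the real recursion *)

(** With u = 1/(k+2) one has 1 - 2u = u k and u (k+1) = 1 - u. Multiplying the recursion by k+1 thus
    gives (k+1) a_(k+1) <= (1 - u) k a_k + c u (1 - u) <= c - c u^2. The induction starts trivially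
    at 0, whatever a_0 is. *)
Lemma inverse_rate (R : realFieldType) (a : nat -> R) (c : R) :
  0 <= c ->
  (forall k, a k.+1 <= (1 - 2 / (k + 2)%:R) * a k + c / (k + 2)%:R ^+ 2) ->
  forall k, k%:R * a k <= c.
Proof.
move=> c0 step; elim=> [|k IHk]; first by rewrite mul0r.
have x0 : 0 <= k%:R :> R by [].
have := step k; rewrite natrD -exprVn -[k.+1%:R]natr1.
set x : R := k%:R in IHk x0 *; set u := (x + 2)^-1.
have ux : u * x = 1 - 2 * u.
  by rewrite /u; field; apply/eqP; lra.
have u0 : 0 < u by rewrite invr_gt0; lra.
have u1 : u < 1 by rewrite invf_lt1; lra.
move=> h.
have h1 : 0 <= (1 - u) * (c - x * a k) by rewrite mulr_ge0 ?subr_ge0// ltW.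
have h2 : (x + 1) * a k.+1 <= (x + 1) * ((1 - 2 * u) * a k + c * u ^+ 2).
  by rewrite ler_wpM2l ?h//; lra.
apply: (le_trans h2).
have -> : (x + 1) * ((1 - 2 * u) * a k + c * u ^+ 2) =
  (u * x + u) * (x * a k) + c * u * (u * x + u).
  by rewrite -ux; ring.
rewrite ux.
have : 0 <= c * u ^+ 2 by rewrite mulr_ge0 ?sqr_ge0.
nra.
Qed.

(** The term of index 0 is kept apart because the rate gives no bound on [a 0]; each later term is
    at most sqrt(c)/sqrt(k). *)
Lemma sum_sqrt_inverse_rate (R : realType) (a : nat -> R) (c : R) (n : nat) :
  (forall k, k%:R * a k <= c) ->
  \sum_(k < n.+2) Num.sqrt (a k) <=
    Num.sqrt (a 0%N) + Num.sqrt c * (2 * Num.sqrt n.+1%:R - 1).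
Proof.
move=> ac; rewrite big_ord_recl lerD2l.
apply: le_trans (ler_wpM2l (sqrtr_ge0 c) (sum_rsqrt_le R n)).
rewrite mulr_sumr; apply: ler_sum => i _.
rewrite ler_pdivlMr ?sqrtr_gt0// mulrC -sqrtrM// ler_wsqrtr//.
Qed.

(** * Deviation bound and decay rate *)

Theorem theorem1 (R : realType) (d : measure_display)
    (Omega : measurableType d) (P : probability Omega R) (m : nat)
    (OmegaS : set (m.-tuple R)) (D : m.-tuple R -> set (R * R))
    (S : nat -> Omega -> m.-tuple R) (L M : m.-tuple R -> R)
    (Tmin Tmax Rmin Rmax C1 C2 thmin thmax th0 b : R)
    (phi : nat -> R * m.-tuple R -> R * R)
    (eta := fun k : nat => 1 / ((k + 2)%:R * Tmin))
    (ths := optimal_ratio P OmegaS D S)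
    (T_ := Tseq S thmin thmax th0 eta phi)
    (R_ := Rseq S thmin thmax th0 eta phi)
    (th_ := theta S thmin thmax th0 eta phi)
    (ratio := ratio_of_averages P S thmin thmax th0 eta phi) :
  renewal_system P OmegaS D S L M ->
  0 < Tmin ->
  moment_bounds P OmegaS D S Tmin Tmax Rmin Rmax C1 C2 ->
  thmin <= ths <= thmax ->
  thmin <= th0 <= thmax ->
  greedy_rule OmegaS D thmin thmax phi ->
  (forall k : nat,
     (2^-1%:E * 'E_P[(fun w => (R_ k w - th_ k w * T_ k w) ^+ 2)%R] <= b%:E)%E) ->
  (forall K : nat, (2 <= K)%N ->
     `|ths - ratio K| <=
       Num.sqrt (2 * C1) / (K%:R * Tmin) *
       (`|th0 - ths| +
        (- Num.sqrt (2 * b) + Num.sqrt (8 * b * (K%:R - 1))) / Tmin)) /\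
  ((fun K : nat => `|ths - ratio K| : R^o) =O_\oo
     (fun K : nat => (Num.sqrt K%:R)^-1 : R^o)).
Proof.
move=> HS Tmin0 HM ths_itv th0_itv HG Hb.
have {}Hb k : (\int[P]_w ((R_ k w - th_ k w * T_ k w) ^+ 2)%:E <= (2 * b)%:E)%E.
  have := Hb k; rewrite unlock EFinM => /(lee_wpmul2l (x := 2%:E)).
  have -> : (2%:E * (2^-1%:E * \int[P]_w ((R_ k w - th_ k w * T_ k w) ^+ 2)%:E) =
      \int[P]_w ((R_ k w - th_ k w * T_ k w) ^+ 2)%:E)%E.
    by rewrite muleA -EFinM mulfV// mul1e.
  by rewrite -EFinM; apply; rewrite lee_fin.
have b0 : 0 <= b.
  have : (0 <= (2 * b)%:E)%E.
    by apply: le_trans (Hb 0%N); apply: integral_ge0 => w _; rewrite lee_fin sqr_ge0.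
  by rewrite lee_fin; lra.
pose a := mean_sqr_dev P OmegaS D S thmin thmax th0 eta phi.
have rate k : k%:R * a k <= 2 * b / Tmin ^+ 2.
  apply: inverse_rate => {k} [|k].
    by rewrite mulr_ge0// ?mulr_ge0// invr_ge0 sqr_ge0.
  have k0 : 0 < (k + 2)%:R :> R by rewrite ltr0n addn2.
  have eta0 : 0 <= eta k by rewrite /eta mul1r invr_ge0 mulr_ge0// ltW.
  apply: le_trans (mean_sqr_dev_step HS Tmin0 HM HG ths_itv th0_itv Hb eta0) _.
  (* The stepsize makes 2 eta Tmin = 2/(k+2) and 2 b eta^2 = (2b/Tmin^2)/(k+2)^2. *)
  rewrite le_eqVlt; apply/orP; left; apply/eqP; rewrite /eta -/a.
  by field; rewrite gt_eqF ?gt_eqF.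
have a0 : Num.sqrt (a 0%N) = `|th0 - ths|.
  by rewrite -sqrtr_sqr; congr Num.sqrt;
    exact (@Rintegral_cst_unit_mass _ _ _ P (probability_setT P) ((th0 - ths) ^+ 2)).
have bound K : (2 <= K)%N -> `|ths - ratio K| <=
    Num.sqrt (2 * C1) / (K%:R * Tmin) *
    (`|th0 - ths| +
     (- Num.sqrt (2 * b) + Num.sqrt (8 * b * (K%:R - 1))) / Tmin).
  case: K => [|[|n]]// _; set K := n.+2.
  have -> : ratio K = (\sum_(k < K) \int[P]_w R_ k w) / (\sum_(k < K) \int[P]_w T_ k w).
    by congr (_ / _); apply: eq_bigr => k _; rewrite unlock.
  set sumR := \sum_(k < K) _; set sumT := \sum_(k < K) _.
  have K0 : 0 < K%:R * Tmin by rewrite mulr_gt0// ltr0n.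
  have sumT_ge : K%:R * Tmin <= sumT.
    have -> : K%:R * Tmin = \sum_(k < K) Tmin.
      by rewrite sumr_const card_ord mulr_natl.
    by apply: ler_sum => k _; exact: (mean_time_ge eta HS HM HG th0_itv).
  have sumT0 : 0 < sumT by exact: lt_le_trans sumT_ge.
  (* The deviation becomes the summed gap over the summed durations, bounded separately above and
     below. *)
  have -> : ths - sumR / sumT = - ((sumR - ths * sumT) / sumT).
    by field; rewrite gt_eqF.
  rewrite normrN normrM normfV (gtr0_norm sumT0) mulrAC.
  have gap : `|sumR - ths * sumT| <= Num.sqrt (2 * C1) * \sum_(k < K) Num.sqrt (a k).
    rewrite /sumR /sumT mulr_sumr -sumrB mulr_sumr.
    apply: le_trans (ler_norm_sum _ _ _) _.
    by apply: ler_sum => k _; exact: (mean_gap_le eta HS Tmin0 HM HG ths_itv th0_itv).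
  apply: ler_pM => //.
  - by rewrite invr_ge0 ltW.
  - apply: le_trans gap _; rewrite ler_wpM2l ?sqrtr_ge0//.
    apply: le_trans (sum_sqrt_inverse_rate n rate) _; rewrite a0 lerD2l.
    have -> : Num.sqrt (2 * b / Tmin ^+ 2) = Num.sqrt (2 * b) / Tmin.
      by rewrite sqrtrM ?mulr_ge0// sqrtrV ?sqr_ge0// sqrtr_sqr gtr0_norm.
    have -> : Num.sqrt (8 * b * (K%:R - 1)) = 2 * Num.sqrt (2 * b) * Num.sqrt n.+1%:R.
      (* Here K - 1 = n + 1, the number of terms left after index 0. *)
      have -> : 8 * b * (K%:R - 1) = 2 ^+ 2 * (2 * b) * n.+1%:R :> R.
        by rewrite /K -[n.+2]addn1 natrD; ring.
      by rewrite -mulrA sqrtrM ?sqr_ge0// sqrtr_sqr ger0_norm// sqrtrM ?mulr_ge0// mulrA.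
    by rewrite le_eqVlt; apply/orP; left; apply/eqP; ring.
  - by rewrite lef_pV2.
split=> //.
(* Constant obtained by dropping -sqrt(2b), replacing K - 1 by K, and using 1 <= sqrt(K) on the
   initial term. *)
pose B := Num.sqrt (2 * C1) / Tmin * (`|th0 - ths| + Num.sqrt (8 * b) / Tmin).
have B0 : 0 <= B.
  rewrite /B mulr_ge0 ?divr_ge0 ?sqrtr_ge0 ?(ltW Tmin0)//.
  by rewrite addr_ge0// divr_ge0 ?sqrtr_ge0// ltW.
(* Adding 1 makes the constant strictly positive. *)
apply/eqO_exP; exists (B + 1); first by rewrite ltr_wpDl.
exists 2%N => // K /= K2.
have K0 : 0 < K%:R :> R by rewrite ltr0n (leq_trans _ K2).
have K1 : 1 <= Num.sqrt K%:R :> R.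
  by rewrite -[leLHS]sqrtr1 ler_wsqrtr// ler1n (leq_trans _ K2).
rewrite normr_id [X in _ * X]ger0_norm ?invr_ge0 ?sqrtr_ge0//.
apply: le_trans (bound _ K2) _.
apply: (@le_trans _ _ (B / Num.sqrt K%:R)); last first.
  by rewrite ler_wpM2r ?invr_ge0 ?sqrtr_ge0// lerDl.
have -> : B / Num.sqrt K%:R = Num.sqrt (2 * C1) / (K%:R * Tmin) *
    (Num.sqrt K%:R * (`|th0 - ths| + Num.sqrt (8 * b) / Tmin)).
  rewrite /B -{2}(sqr_sqrtr (ltW K0)); field.
  by rewrite !gt_eqF// (lt_le_trans ltr01).
rewrite ler_wpM2l ?divr_ge0 ?sqrtr_ge0 ?mulr_ge0 ?(ltW K0) ?(ltW Tmin0)//.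
rewrite [leRHS]mulrDr lerD//; first by rewrite ler_peMl.
rewrite mulrA ler_wpM2r ?invr_ge0 ?(ltW Tmin0)//.
apply: (@le_trans _ _ (Num.sqrt (8 * b * (K%:R - 1)))).
  by rewrite gerDr oppr_le0 sqrtr_ge0.
by rewrite [leRHS]mulrC -sqrtrM ?mulr_ge0// ler_wsqrtr// ler_wpM2l ?mulr_ge0// gerBl.
Qed.
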